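(* Let $X$ be a scalar homogeneous random field on $T$ over $(\Omega_X,\mathcal F_X,P_X)$ with $E_X[(X(0))^2]<\infty$ and $\mathrm{Var}_X[X(0)\mid\mathcal I_X]>0$ with $P_X$-probability 1, let $\{T_n\}$ be a pointwise averaging sequence of sets in $T$, let $k_n\in\mathbb N$, $k_n\uparrow\infty$, and for each $n$ let $\tau_{n,1},\dots,\tau_{n,k_n}$ be i.i.d. points uniformly distributed on $T_n$, independent of $X$. Then for $P_X$-almost all $\omega\in\Omega_X$ the Lindeberg condition is fulfilled: for each $\varepsilon>0$, as $n\to\infty$, $$L_n(\omega):=\frac{\sum_{i=1}^{k_n}E_\tau\big[(X(\tau_{n,i},\omega)-M_n(\omega))^2\,\mathbf 1_{B_{n,i}}\big]}{k_nV_n(\omega)}\to0,$$ where $B_{n,i}=\{|X(\tau_{n,i},\omega)-M_n(\omega)|>\varepsilon\, k_n^{1/2}(V_n(\omega))^{1/2}\}$.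
   Context: $T=\mathbb R^m$ or $T=\mathbb Z^m$, $m\ge1$; $\mathcal B$ is the Borel $\sigma$-field of $T$ (all subsets if $T=\mathbb Z^m$); $\lambda$ is Lebesgue measure on $\mathbb R^m$, resp. counting measure on $\mathbb Z^m$. A random field is a family $X(t)$, $t\in T$, of random variables on a probability space $(\Omega_X,\mathcal F_X,P_X)$ (expectation $E_X$); when $T=\mathbb R^m$ the map $(t,\omega)\mapsto X(t,\omega)$ is assumed $\mathcal B\otimes\mathcal F_X$-measurable. A field is homogeneous if all its finite-dimensional distributions are invariant under shifts of $T$. For a homogeneous field $Y$, $\mathcal I_Y$ denotes the $\sigma$-field of events $\{Y\in A\}$, $A$ in the product $\sigma$-field of the space of functions on $T$, with $P_X(\{Y\in A\}\triangle\{Y(\cdot+t)\in A\})=0$ for all $t\in T$. $\mathrm{Var}_X[\cdot\mid\mathcal I]$ is the conditional variance. Pointwise averaging: a sequence $\{T_n\}$ of bounded Borel subsets of $T$ with $\lambda(T_n)>0$, $\lambda(T_n)\to\infty$, is pointwise averaging if for every scalar homogeneous random field $Y$ on $T$ (over any probability space) and every measurable $f:\mathbb R\to\mathbb R$ with $E[|f(Y(0))|]<\infty$, with probability 1, $\lim_{n}\frac1{\lambda(T_n)}\int_{T_n}f(Y(t))\lambda(dt)=E[f(Y(0))\mid\mathcal I_Y]$. The points $\tau_{n,i}$ live on a probability space $(\Omega_\tau,\mathcal F_\tau,P_\tau)$ with expectation $E_\tau$ (so $\omega$ is fixed in $E_\tau$); for each $n$ they are uniform on $T_n$ with respect to $\lambda$.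 $M_n:=\frac1{\lambda(T_n)}\int_{T_n}X(t)\lambda(dt)$ and $V_n:=\frac1{\lambda(T_n)}\int_{T_n}(X(t)-M_n)^2\lambda(dt)$. A quotient with zero denominator is set to $0$. *)

(* Defs.v *)
(* Library world: MathComp with MathComp-Analysis. *)
From HB Require Import structures.
From mathcomp Require Import all_boot all_order all_algebra.
From mathcomp Require Import all_classical all_reals all_analysis.
From mathcomp Require Import measurable_realfun.
Set Implicit Arguments.
Unset Strict Implicit.
Unset Printing Implicit Defensive.
Import Order.TTheory GRing.Theory Num.Theory.
Import numFieldNormedType.Exports.
Local Open Scope classical_set_scope.
Local Open Scope ring_scope.

(* A single type family covers both parameter spaces R^m and Z^m, so that it can
   carry the additive group and the sigma-field at the same time. *)
Variant index_kind := Euclidean | Lattice.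

Definition index_space (R : realType) (m : nat) (c : index_kind) : Type :=
  match c with Euclidean => 'rV[R]_m | Lattice => 'rV[int]_m end.

Section index_space_structures.
Context (R : realType) (m : nat) (c : index_kind).

HB.instance Definition _ : GRing.Zmodule (index_space R m c) :=
  match c return GRing.Zmodule (index_space R m c) with
  | Euclidean => GRing.Zmodule.on 'rV[R]_m
  | Lattice => GRing.Zmodule.on 'rV[int]_m
  end.
HB.instance Definition _ := isPointed.Build (index_space R m c) 0.

Definition index_measurable : set (set (index_space R m c)) :=
  match c return set (set (index_space R m c)) with
  | Euclidean => <<s @open 'rV[R]_m >>
  | Lattice => setT
  end.

Let index_measurable0 : index_measurable set0.
Proof. by rewrite /index_measurable; case: c => //; exact: sigma_algebra0. Qed.
Let index_measurableC A : index_measurable A -> index_measurable (~` A).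
Proof.
by move: A; rewrite /index_measurable; case: c => // A; exact: sigma_algebraC.
Qed.
Let index_measurable_bigcup (F : (set (index_space R m c))^nat) :
  (forall i, index_measurable (F i)) -> index_measurable (\bigcup_i F i).
Proof.
move: F; rewrite /index_measurable; case: c => // F.
exact: sigma_algebra_bigcup.
Qed.

HB.instance Definition _ := @isMeasurable.Build default_measure_display
  (index_space R m c) index_measurable index_measurable0
  index_measurableC index_measurable_bigcup.
End index_space_structures.

(* The inverse [g] is only used for sigma-finiteness of the image measure. *)
Section transport.
Local Open Scope ereal_scope.
Context d1 d2 (T1 : measurableType d1) (T2 : measurableType d2) (R : realType)
  (mu : {sigma_finite_measure set T1 -> \bar R}).
Variables (f : T1 -> T2) (g : T2 -> T1).
Hypotheses (mf : measurable_fun setT f) (mg : measurable_fun setT g).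
Hypothesis fK : cancel f g.

Let image_measure := pushforward mu f.

Let image_measure0 : image_measure set0 = 0.
Proof. exact: measure0. Qed.

Let image_measure_ge0 A : 0 <= image_measure A.
Proof. exact: measure_ge0. Qed.

Let image_measure_sigma_additive : semi_sigma_additive image_measure.
Proof. exact: measure_semi_sigma_additive. Qed.

HB.instance Definition _ := isMeasure.Build _ _ _ image_measure
  image_measure0 image_measure_ge0 image_measure_sigma_additive.

Let image_measure_sigma_finite : sigma_finite setT image_measure.
Proof.
have [F TF mF] := sigma_finiteT mu.
exists (fun i => g @^-1` F i).
  by rewrite -preimage_bigcup -TF preimage_setT.
move=> i; have [mFi Foo] := mF i; split.
  by rewrite -[X in measurable X]setTI; exact: mg.
rewrite /image_measure /pushforward -comp_preimage.
by rewrite (_ : _ \o _ = id) ?preimage_id//; apply/funext => x; exact: fK.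
Qed.

HB.instance Definition _ := Measure_isSigmaFinite.Build _ _ _ image_measure
  image_measure_sigma_finite.

Definition transport : {sigma_finite_measure set T2 -> \bar R} := image_measure.

End transport.

(* The library declares [mu \x nu] sigma-finite, but that instance is shadowed by
   the one for subprobabilities. *)
Section product_sigma_finite.
Local Open Scope ereal_scope.
Context d1 d2 (T1 : measurableType d1) (T2 : measurableType d2) (R : realType)
  (mu : {sigma_finite_measure set T1 -> \bar R})
  (nu : {sigma_finite_measure set T2 -> \bar R}).

Let product := mu \x nu.

HB.instance Definition _ := Measure.on product.

Let product_sigma_finite_subproof : sigma_finite setT product.
Proof.
have /sigma_finiteP[F [TF ndF Foo]] := sigma_finiteT mu.
have /sigma_finiteP[G [TG ndG Goo]] := sigma_finiteT nu.
exists (fun n => F n `*` G n).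
  rewrite -setXTT TF TG predeqE => -[x y]; split.
    move=> [/= [n _ Fnx] [k _ Gky]]; exists (maxn n k) => //; split.
    - by move: x Fnx; exact/subsetPset/ndF/leq_maxl.
    - by move: y Gky; exact/subsetPset/ndG/leq_maxr.
  by move=> [n _ []/= ? ?]; split; exists n.
move=> k; have [? ?] := Foo k; have [? ?] := Goo k.
split; first exact: measurableX.
by rewrite /product product_measure1E// lte_mul_pinfty// ge0_fin_numE.
Qed.

HB.instance Definition _ := Measure_isSigmaFinite.Build _ _ _ product
  product_sigma_finite_subproof.

Definition product_sigma_finite :
  {sigma_finite_measure set (T1 * T2)%type -> \bar R} := product.
End product_sigma_finite.

Section lebesgue_row.
Context (R : realType).

Let tcons n (p : R * n.-tuple R) : n.+1.-tuple R :=
  [the n.+1.-tuple R of p.1 :: p.2].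
Let tuncons n (t : n.+1.-tuple R) : R * n.-tuple R :=
  (thead t, [tuple of behead t]).

Let measurable_tcons n : measurable_fun setT (@tcons n).
Proof. exact: measurable_cons. Qed.

Let measurable_tuncons n : measurable_fun setT (@tuncons n).
Proof.
by apply/measurable_fun_pair => /=; [exact: measurable_tnth|exact: measurable_behead].
Qed.

Let tconsK n : cancel (@tcons n) (@tuncons n).
Proof. by case=> x t; congr pair; apply: val_inj. Qed.

(* [lebesgue_measure] lives on [measurableTypeR R], which has the same
   measurable sets as [R] but another display. *)
Let mid1 : measurable_fun setT (id : measurableTypeR R -> R).
Proof. by move=> _ A mA; rewrite setTI. Qed.
Let mid2 : measurable_fun setT (id : R -> measurableTypeR R).
Proof. by move=> _ A mA; rewrite setTI. Qed.

Definition lebesgue1 : {sigma_finite_measure set R -> \bar R} :=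
  transport (@lebesgue_measure R) mid1 mid2 (fun=> erefl).

Fixpoint lebesgue_tuple n : {sigma_finite_measure set (n.-tuple R) -> \bar R} :=
  match n with
  | 0 => \d_ [tuple]
  | n.+1 => transport (product_sigma_finite lebesgue1 (lebesgue_tuple n))
              (@measurable_tcons n) (@measurable_tuncons n) (@tconsK n)
  end.

Let lebesgue_tuple_box n (B : 'I_n -> set R) : (forall i, measurable (B i)) ->
  lebesgue_tuple n [set t | forall i, B i (tnth t i)] =
  (\prod_(i < n) lebesgue_measure (B i))%E.
Proof.
elim: n B => [|n IH] B mB.
  by rewrite big_ord0 /= diracE mem_set//= => -[].
rewrite big_ord_recl -IH//.
rewrite -[LHS]/((lebesgue1 \x lebesgue_tuple n)%E (@tcons n @^-1` _)).
pose D := [set t : n.-tuple R | forall i, B (lift ord0 i) (tnth t i)].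
rewrite (_ : @tcons n @^-1` _ = B ord0 `*` D); last first.
  apply/seteqP; split => -[x t] /=.
    by move=> H; split; [exact: (H ord0)|move=> i; have := H (lift ord0 i); rewrite tnthS].
  move=> [Bx Bt] i; case: (unliftP ord0 i) => [j ->|->//].
  by rewrite tnthS; exact: Bt.
apply: product_measure1E => //.
rewrite /D (_ : [set t | _] = \bigcap_(i in [set: 'I_n])
    (@tnth _ R ^~ i @^-1` B (lift ord0 i))); last first.
  by apply/seteqP; split => [t Ht i _|t Ht i]; exact: Ht.
apply: fin_bigcap_measurable => // i _.
by rewrite -[X in measurable X]setTI; exact: measurable_tnth.
Qed.

Context (m : nat).
Local Notation Rm := (index_space R m Euclidean).

Let row_of (t : m.-tuple R) : Rm := \row_i tnth t i.
Let tuple_of (x : Rm) : m.-tuple R := [tuple (x : 'rV[R]_m) 0 i | i < m].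

Let row_ofK : cancel row_of tuple_of.
Proof. by move=> t; apply: eq_from_tnth => i; rewrite tnth_mktuple mxE. Qed.

Let measurable_tuple_of : measurable_fun setT tuple_of.
Proof.
apply/measurable_fun_tnthP => i.
have -> : @tnth _ R ^~ i \o tuple_of = fun x : 'rV[R]_m => x 0 i.
  by apply/funext => x /=; rewrite tnth_mktuple.
apply: (@measurability _ _ _ _ setT _ (@RGenOInfty.G R)).
  by rewrite /measurable/= /measurableR RGenOInfty.measurableE.
move=> _ [_ [a ->] <-]; rewrite setTI; apply: sub_sigma_algebra.
apply: open_comp; first by move=> x _; exact: coord_continuous.
exact: rray_open.
Qed.

Let measurable_row_of : measurable_fun setT row_of.
Proof.
apply: (@measurability _ _ _ Rm setT row_of (@open 'rV[R]_m : set (set Rm))) => //.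
move=> _ [U oU <-]; rewrite setTI.
pose box (p : 'rV[rat]_m * nat) : set 'rV[R]_m :=
  [set x | forall i, `|ratr (p.1 0 i) - x 0 i| < p.2.+1%:R^-1].
have -> : U = \bigcup_(p in [set p | box p `<=` U]) box p.
  apply/seteqP; split => [x Ux|x [p pU]]; last exact: pU.
  have /nbhs_ballP[e /= e0 xeU] := open_nbhs_nbhs (conj oU Ux).
  have [k _ ke] : exists2 k : nat, True & k.+1%:R^-1 < e / 2.
    have /cvgrPdist_lt/(_ (e/2)) := @cvg_harmonic R.
    move=> /(_ ltac:(by rewrite divr_gt0)) [k _ /(_ k (leqnn k))]/=.
    by rewrite sub0r normrN ger0_norm//; exists k.
  have k0 : 0 < k.+1%:R^-1 :> R by rewrite invr_gt0.
  have qP i : {q : rat | `|ratr q - x 0 i| < k.+1%:R^-1 :> R}.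
    apply: cid.
    have [q] := @rat_in_itvoo R (x 0 i) (x 0 i + k.+1%:R^-1) ltac:(by rewrite ltrDl).
    rewrite in_itv/= => /andP[q1 q2]; exists q.
    by rewrite ger0_norm ?subr_ge0 ?(ltW q1)// ltrBlDl.
  exists (\row_i sval (qP i), k) => /=.
    move=> y /= Hy; apply: xeU; split => // i j.
    rewrite (ord1 i) /ball /= (le_lt_trans (ler_distD (ratr (sval (qP j))) _ _))//.
    have := Hy j; rewrite mxE => Hyj.
    rewrite distrC (splitr e) ltrD//; apply: lt_trans ke => //.
    exact: (svalP (qP j)).
  by move=> i; rewrite mxE; exact: (svalP (qP i)).
rewrite preimage_bigcup bigcup_mkcond.
apply: countable_bigcupT_measurable => // p; case: ifPn => // _.
rewrite (_ : row_of @^-1` box p = \bigcap_(i in [set: 'I_m])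
    (@tnth _ R ^~ i @^-1` ball (ratr (p.1 0 i) : R) p.2.+1%:R^-1)); last first.
  by apply/seteqP; split => [t Ht i _|t Ht i]; have := Ht i; rewrite /= mxE//; exact.
apply: fin_bigcap_measurable => // i _.
by rewrite -[X in measurable X]setTI; apply: measurable_tnth => //; exact: measurable_ball.
Qed.

Definition lebesgue_row : {sigma_finite_measure set Rm -> \bar R} :=
  transport (lebesgue_tuple m) measurable_row_of measurable_tuple_of row_ofK.

Lemma lebesgue_row_box (B : 'I_m -> set R) : (forall i, measurable (B i)) ->
  lebesgue_row [set x : 'rV[R]_m | forall i, B i (x 0 i)] =
  (\prod_(i < m) lebesgue_measure (B i))%E.
Proof.
move=> mB; rewrite -lebesgue_tuple_box//.
rewrite -[LHS]/(lebesgue_tuple m (row_of @^-1` _)); congr (lebesgue_tuple _ _).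
by apply/seteqP; split => t /= Ht i; have := Ht i; rewrite mxE.
Qed.
End lebesgue_row.


Section counting_row.
Context (R : realType) (m : nat).
Local Notation Zm := (index_space R m Lattice).

Let counting_row_sigma_finite :
  sigma_finite setT (counting : set Zm -> \bar R).
Proof.
exists (fun n => [set x : Zm | (pickle (x : 'rV[int]_m) <= n)%N]).
    by apply/seteqP; split => // x _; exists (pickle (x : 'rV[int]_m)) => /=.
move=> n; split => //; rewrite /counting asboolT ?ltry//.
apply: (@sub_finite_set _ _
  ((fun k => odflt 0 (unpickle k : option 'rV[int]_m)) @` `I_n.+1)).
  by move=> x /= xn; exists (pickle (x : 'rV[int]_m)); rewrite ?pickleK.
exact/finite_image/finite_II.
Qed.

HB.instance Definition _ := Measure_isSigmaFinite.Build _ _ _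
  (counting : set Zm -> \bar R) counting_row_sigma_finite.
Definition counting_row : {sigma_finite_measure set Zm -> \bar R} := counting.
End counting_row.

Definition reference_measure (R : realType) (m : nat) (c : index_kind) :
    {sigma_finite_measure set (index_space R m c) -> \bar R} :=
  match c with
  | Euclidean => lebesgue_row R m
  | Lattice => counting_row R m
  end.

Section conditional_expectation.
Context d (W : measurableType d) (R : realType) (P : probability W R).

Definition is_cond_expectation (G : set (set W)) (Z g : W -> R) : Prop :=
  [/\ forall B, measurable B -> G (g @^-1` B),
      P.-integrable setT (EFin \o g) &
      forall A, G A ->
        (\int[P]_(w in A) (g w)%:E = \int[P]_(w in A) (Z w)%:E)%E].

(* An arbitrary version; one exists as soon as [Z] is integrable and [G] is a
   sub-sigma-field, see [cond_expectationP]. *)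
Definition cond_expectation (G : set (set W)) (Z : W -> R) : W -> R :=
  xget (cst 0) [set g | is_cond_expectation G Z g].

Definition cond_variance (G : set (set W)) (Z : W -> R) : W -> R :=
  cond_expectation G (fun w => (Z w - cond_expectation G Z w) ^+ 2).
End conditional_expectation.

Lemma cond_expectationP d (W : measurableType d) (R : realType)
    (P : probability W R) (G : set (set W)) (Z : W -> R) :
  sigma_algebra setT G -> G `<=` measurable ->
  P.-integrable setT (EFin \o Z) ->
  is_cond_expectation P G Z (cond_expectation P G Z).
Proof.
move=> sG Gm intZ; apply: xgetPex.
pose H := g_sigma_algebraType G.
have GE : (measurable : set (set H)) = G by exact: sigma_algebra_id.
have mid : measurable_fun setT (id : W -> H).
  by move=> _ A; rewrite GE setTI => /Gm.
pose idW : {mfun W >-> H} := HB.pack (id : W -> H) (isMeasurableFun.Build _ _ _ _ _ mid).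
pose Q : probability H R := distribution P idW.
pose nu0 : {charge set W -> \bar R} := induced_charge intZ.
have nu_fin A : (measurable : set (set H)) A -> nu0 A \is a fin_num.
  by rewrite GE => /Gm mA; exact: fin_num_measure.
have nu_sigma : semi_sigma_additive (nu0 : set H -> \bar R).
  move=> F mF tF mUF; apply: charge_semi_sigma_additive => //.
    by move=> n; apply: Gm; have := mF n; rewrite GE.
  by apply: Gm; rewrite -GE.
pose nu : {charge set H -> \bar R} :=
  HB.pack (nu0 : set H -> \bar R)
    (isCharge.Build _ H R (nu0 : set H -> \bar R) (charge0 nu0) nu_fin nu_sigma).
have nuQ : nu `<< Q.
  apply/null_content_dominatesP => A; rewrite GE => /Gm mA QA0.
  change (\int[P]_(w in A) (EFin \o Z) w = 0)%E.
  by apply: null_set_integral => //; apply: measurable_funTS; exact: measurable_int intZ.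
pose f := Radon_Nikodym nu Q.
have intf : Q.-integrable setT f by exact: Radon_Nikodym_integrable.
have ff x : f x \is a fin_num by exact: Radon_Nikodym_fin_num.
have mf : measurable_fun [set: H] f by exact: measurable_int intf.
have mfW : measurable_fun [set: W] (f : W -> \bar R).
  by move=> _ B mB; rewrite setTI; apply: Gm; rewrite -GE -[X in measurable X]setTI; exact: mf.
have intfW : P.-integrable setT (f : W -> \bar R).
  apply/integrableP; split => //; move/integrableP : intf => [_].
  by rewrite ge0_integral_pushforward//; exact: measurableT_comp.
have fE : EFin \o (fine \o f) = f by apply/funext => x /=; rewrite fineK.
exists (fine \o f); split.
- have mff : measurable_fun [set: H] (fine \o f) by exact: measurableT_comp.
  by move=> B mB; rewrite -GE -[X in measurable X]setTI; exact: mff.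
- by rewrite fE.
- move=> A GA; have mA : (measurable : set (set H)) A by rewrite GE.
  under eq_integral do rewrite -[(fine _)%:E]/((EFin \o (fine \o f)) _) fE.
  rewrite -[RHS]/(nu A) (Radon_Nikodym_integral nuQ mA) -/f.
  rewrite integral_pushforward//.
  by apply: (integrableS measurableT) => //; exact: Gm.
Qed.

Section random_fields.
Context (R : realType) (m : nat) (c : index_kind).
Local Notation T := (index_space R m c).
Local Notation lambda := (reference_measure R m c).

Definition random_field d (W : measurableType d) (Y : T -> W -> R) : Prop :=
  (forall t, measurable_fun setT (Y t)) /\
  (c = Euclidean -> measurable_fun setT (fun p : T * W => Y p.1 p.2)).

Definition homogeneous d (W : measurableType d) (P : probability W R)
    (Y : T -> W -> R) : Prop :=
  forall n (t : 'I_n -> T) (s : T) (B : set (n.-tuple R)), measurable B ->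
    P [set w | B [tuple Y (t i + s) w | i < n]] =
    P [set w | B [tuple Y (t i) w | i < n]].

Definition path_sigma_field : set (set (T -> R)) :=
  <<s \bigcup_(t in [set: T])
        preimage_set_system setT (fun y : T -> R => y t) measurable >>.

Definition invariant_events d (W : measurableType d) (P : probability W R)
    (Y : T -> W -> R) : set (set W) :=
  [set E | exists A, [/\ path_sigma_field A, E = [set w | A (Y ^~ w)] &
    forall t, P (E `+` [set w | A (fun s => Y (s + t) w)]) = 0%E]].

(* A subset of Z^m is bounded when it is bounded as a subset of R^m. *)
Definition bounded_index : set T -> Prop :=
  match c return set (index_space R m c) -> Prop with
  | Euclidean => fun A => bounded_set (A : set 'rV[R]_m)
  | Lattice => fun A =>
      bounded_set [set (map_mx intr (x : 'rV[int]_m) : 'rV[R]_m) | x in A]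
  end.

(* [Rintegral] is 0 when the integral is infinite or undefined; for the fields
   below this concerns only a null set of realizations. *)
Definition space_mean (A : set T) (g : T -> R) : R :=
  (fine (lambda A))^-1 * \int[lambda]_(t in A) g t.

Definition pointwise_averaging (S : nat -> set T) : Prop :=
  [/\ forall n, [/\ measurable (S n), bounded_index (S n) &
                    (0 < lambda (S n))%E],
      lambda (S n) @[n --> \oo] --> +oo%E &
      forall d (W : measurableType d) (P : probability W R) (Y : T -> W -> R)
          (f : R -> R),
        random_field Y -> homogeneous P Y -> measurable_fun setT f ->
        ('E_P[fun w => `|f (Y 0 w)|%R] < +oo)%E ->
        {ae P, forall w, space_mean (S n) (fun t => f (Y t w)) @[n --> \oo] -->
          cond_expectation P (invariant_events P Y) (fun w => f (Y 0 w)) w}].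

Definition uniform_on d (W : measurableType d) (P : probability W R)
    (A : set T) (tau : W -> T) : Prop :=
  forall B, measurable B ->
    P (tau @^-1` B) = (fine (lambda (B `&` A)) / fine (lambda A))%:E.

Definition mutually_independent d (W : measurableType d) (P : probability W R)
    k (tau : 'I_k -> W -> T) : Prop :=
  forall (J : {set 'I_k}) (B : 'I_k -> set T), (forall i, measurable (B i)) ->
    P (\bigcap_(i in [set` J]) (tau i @^-1` B i)) =
    (\prod_(i in J) P (tau i @^-1` B i))%E.

Definition sample_variance (A : set T) (g : T -> R) : R :=
  space_mean A (fun t => (g t - space_mean A g) ^+ 2).

(* [g] is one realization of the field: the expectation is over the points only,
   which live on their own probability space and hence are independent of the
   field. The division by zero yields 0. *)
Definition lindeberg_ratio d (W : measurableType d) (P : probability W R)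
    (A : set T) k (tau : 'I_k -> W -> T) (g : T -> R) (eps : R) : R :=
  let M := space_mean A g in
  let V := sample_variance A g in
  (\sum_(i < k) fine 'E_P[fun z => (g (tau i z) - M) ^+ 2 *
     \1_[set z | eps * Num.sqrt k%:R * Num.sqrt V < `|g (tau i z) - M|] z]) /
  (k%:R * V).
End random_fields.

Section invariant_events_sigma_algebra.
Context (R : realType) (m : nat) (c : index_kind) d (W : measurableType d)
  (P : probability W R) (Y : index_space R m c -> W -> R).
Hypothesis mY : forall t, measurable_fun setT (Y t).

Let measurable_path (s : index_space R m c) A : @path_sigma_field R m c A ->
  measurable [set w | A (fun t => Y (t + s) w)].
Proof.
pose F := [set A : set (index_space R m c -> R) |
  measurable [set w | A (fun t => Y (t + s) w)]].
apply: (@smallest_sub _ (sigma_algebra setT) _ F).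
  split => [|B FB|B FB].
  - by rewrite /F/= (_ : [set _ | _] = set0)//; apply/seteqP; split.
  - rewrite /F/= (_ : [set _ | _] = ~` [set w | B (fun t => Y (t + s) w)]).
      exact: measurableC.
    by apply/seteqP; split => w /=; [case|].
  - rewrite /F/= (_ : [set _ | _] =
        \bigcup_i [set w | B i (fun t => Y (t + s) w)])//.
    exact: bigcupT_measurable.
move=> _ [t _ [B mB <-]]; rewrite /F/= -[X in measurable X]setTI.
rewrite (_ : [set w | _] = Y (t + s) @^-1` B); first exact: mY.
by apply/seteqP; split => w /=; [case|].
Qed.

Lemma invariant_events_measurable : invariant_events P Y `<=` measurable.
Proof.
move=> _ [A [sA -> _]]; have := measurable_path 0 sA.
by under eq_set do under eq_fun do rewrite addr0.
Qed.

Lemma sigma_algebra_invariant_events : sigma_algebra setT (invariant_events P Y).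
Proof.
have [p0 pC pU] := @smallest_sigma_algebra (index_space R m c -> R) setT
  (\bigcup_(t in [set: index_space R m c])
     preimage_set_system setT (fun y : _ -> R => y t) measurable).
split => [|E [A [sA -> PA]]|E /= EP].
- exists set0; split => // t.
  by rewrite (_ : _ `+` _ = set0) ?measure0//; apply/seteqP; split => w // [[]|[]].
- exists (setT `\` A); split => [||t]; first exact: pC.
    by apply/seteqP; split.
  rewrite -(PA t); congr (P _); apply/seteqP.
  by split => w /=; rewrite /setY/setD/setU/=;
    have [?|?] := pselect (A (Y ^~ w));
    have [?|?] := pselect (A (fun s => Y (s + t) w)); tauto.
- have [A AE] := choice EP.
  exists (\bigcup_i A i); split => [||t].
  + by apply: pU => i; have [] := AE i.
  + apply/seteqP; split => w [i _ Eiw]; exists i => //; have [_ + _] := AE i.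
      by move=> e; move: Eiw; rewrite e.
    by move=> ->.
  + have mE := invariant_events_measurable.
    have mEi i : measurable (E i) by apply: mE; exact: EP.
    apply: measure_negligible.
      have mA i : measurable [set w | A i (fun s => Y (s + t) w)].
        by apply: measurable_path; have [] := AE i.
      have mU : measurable (\bigcup_i E i) by exact: bigcupT_measurable.
      have mV : measurable [set w | (\bigcup_i A i) (fun s => Y (s + t) w)].
        exact: (@bigcupT_measurable _ _ (fun i => [set w | A i (fun s => Y (s + t) w)])).
      by apply: measurableU; exact: measurableD.
    have : P.-negligible (\bigcup_i (E i `+` [set w | A i (fun s => Y (s + t) w)])).
      apply: negligible_bigcup => i; have [sA _ P0] := AE i.
      have mA : measurable [set w | A i (fun s => Y (s + t) w)].
        exact: measurable_path.
      by apply/negligibleP; [apply: measurableU; exact: measurableD|exact: P0].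
    apply: negligibleS.
      move=> w [[[i _ Ew] nA]|[[i _ Aw] nE]]; exists i => //.
        by left; split => // Aw; apply: nA; exists i.
      by right; split => // Ew; apply: nE; exists i.
Qed.
End invariant_events_sigma_algebra.

(* Main.v *)
(* For almost every realization x of the field, averaging applied to x, to x^2
   and to x^2 1{|x| > K} for all natural K gives M_n -> E[X(0) | I],
   V_n -> E[X(0)^2 | I] - E[X(0) | I]^2 > 0, and convergence of the tail averages
   to a_K = E[X(0)^2 1{|X(0)| > K} | I], where inf_K a_K = 0. The points
   being uniform, L_n is the average over T_n of
   (x - M_n)^2 1{|x - M_n| > eps (k_n V_n)^(1/2)}, divided by V_n. The threshold
   tends to infinity and M_n is bounded, so for each large K this average is
   eventually at most 4 times the average of x^2 1{|x| > K}, whence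
   limsup L_n <= 4 a_K / lim V_n. *)
Require Import Defs.
From mathcomp Require Import all_boot all_order all_algebra.
From mathcomp Require Import all_classical all_reals all_analysis.
From mathcomp Require Import measurable_realfun.
From mathcomp Require Import zify lra ring.
Set Implicit Arguments.
Unset Strict Implicit.
Unset Printing Implicit Defensive.
Import Order.TTheory GRing.Theory Num.Theory.
Import numFieldNormedType.Exports.
Local Open Scope classical_set_scope.
Local Open Scope ring_scope.

(** * Bounded index sets, measurability of fields, integrals along realizations *)

Lemma coord_le_mx_norm (K : realDomainType) n (x : 'rV[K]_n) (i : 'I_n) :
  `|x 0 i| <= mx_norm x.
Proof.
rewrite mx_normrE.
exact: (@le_bigmax _ _ _ 0 (fun p : 'I_1 * 'I_n => `|x p.1 p.2|) (0, i)).
Qed.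

Section index_space.
Context (R : realType) (m : nat) (c : index_kind).
Local Notation T := (index_space R m c).
Local Notation lambda := (reference_measure R m c).

(** A bounded Euclidean set lies in an open cube, whose volume is a finite product of lengths; a
    bounded set of lattice points is finite. Finiteness matters because [fine] would send an
    infinite volume to 0. *)
Lemma bounded_index_lty (A : set T) :
  measurable A -> bounded_index A -> (lambda A < +oo)%E.
Proof.
case: c A => A mA /= /ex_strict_bound_gt0[M M0 AM].
  pose B := [set x : 'rV[R]_m | forall i, `](- M), M[%classic (x 0 i)].
  have mB : @measurable _ (index_space R m Euclidean) B.
    rewrite (_ : B = \bigcap_(i in [set: 'I_m])
      ((fun x : 'rV[R]_m => x 0 i) @^-1` `](- M), M[%classic)); last first.
      by apply/seteqP; split => [x Bx i _|x Bx i]; exact: Bx.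
    apply: (@fin_bigcap_measurable _ (index_space R m Euclidean)) => // i _.
    apply: sub_sigma_algebra; apply: open_comp; last exact: interval_open.
    by move=> x _; exact: coord_continuous.
  have AB : A `<=` B.
    move=> x /AM xM i; rewrite /= in_itv /= -ltr_norml.
    exact: le_lt_trans (coord_le_mx_norm x i) xM.
  apply: (@le_lt_trans _ _ (lebesgue_row R m B)).
    exact: (le_measure (lebesgue_row R m) (mem_set mA) (mem_set mB) AB).
  rewrite /B (@lebesgue_row_box R m (fun=> `](- M), M[%classic))//.
  rewrite lebesgue_measure_itv/=.
  rewrite lte_fin gtrN// -EFinB prodEFin; exact: ltry.
rewrite /counting asboolT ?ltry//.
pose N := Num.bound M.
(* [F] lists all integer vectors with entries in [-N, N]: each coordinate has 2N + 1 codes, shifted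
   down by N. *)
pose F (f : {ffun 'I_m -> 'I_(N + N).+1}) : 'rV[int]_m :=
  \row_i ((f i : nat)%:Z - N%:Z).
apply: (@sub_finite_set _ _ (F @` setT)); last exact: finite_image.
move=> x Ax.
have xN i : `|(x : 'rV[int]_m) 0 i| <= N%:Z.
  have xM := AM _ (imageP _ Ax).
  have := le_lt_trans (coord_le_mx_norm _ i) xM.
  rewrite mxE => /lt_trans/(_ (archi_boundP (ltW M0))).
  by rewrite -intr_norm pmulrn ltr_int => /ltW.
exists [ffun i => inord (absz ((x : 'rV[int]_m) 0 i + N%:Z))] => //.
apply/rowP => i; rewrite mxE ffunE; have := xN i.
rewrite ler_norml => /andP[h1 h2]; rewrite inordK; lia.
Qed.

(** On the lattice, joint measurability comes from countability: the preimage of B is a countable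
    union of rectangles {t} x {Y(t) in B}. *)
Lemma random_field_measurable d (W : measurableType d) (Y : T -> W -> R) :
  random_field Y -> measurable_fun setT (fun p : T * W => Y p.1 p.2).
Proof.
case; case: c Y => Y mY; first exact.
move=> _ _ B mB; rewrite setTI.
rewrite (_ : _ @^-1` B = \bigcup_(n : nat)
    (* Where [unpickle] fails, the default index 0 merely repeats the rectangle at t = 0. *)
    let t := odflt 0 (unpickle n : option 'rV[int]_m) in
    [set t : index_space R m Lattice] `*` (Y t @^-1` B)); last first.
  apply/seteqP; split => [[t w] /= Btw|[t w] [n _] [/= -> //]].
  by exists (pickle (t : 'rV[int]_m)) => //=; rewrite pickleK.
apply: bigcupT_measurable => n /=; apply: measurableX => //.
by rewrite -[X in measurable X]setTI; exact: mY.
Qed.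

Lemma random_field_path d (W : measurableType d) (Y : T -> W -> R) w :
  random_field Y -> measurable_fun setT (Y ^~ w).
Proof.
move=> /random_field_measurable mY.
exact: (measurableT_comp mY (pair2_measurable w)).
Qed.

(** Shifting the single point 0 by t in the definition of homogeneity shows that Y(t) and Y(0) have
    the same law. *)
Lemma homogeneous_integral d (W : measurableType d) (P : probability W R)
    (Y : T -> W -> R) (f : R -> \bar R) (t : T) :
  (forall t, measurable_fun setT (Y t)) -> homogeneous P Y ->
  measurable_fun setT f -> (forall x, 0 <= f x)%E ->
  (\int[P]_w f (Y t w) = \int[P]_w f (Y 0%R w))%E.
Proof.
move=> mY hY mf f0.
rewrite -[LHS](@ge0_integral_pushforward _ _ _ _ _ (Y t) (mY t) P setT f)//.
rewrite -[RHS](@ge0_integral_pushforward _ _ _ _ _ (Y 0) (mY 0) P setT f)//.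
apply: eq_measure_integral => B mB _; rewrite /pushforward.
have mB1 : measurable ((fun u : 1.-tuple R => thead u) @^-1` B).
  by rewrite -[X in measurable X]setTI; exact: measurable_tnth.
have := hY 1%N (fun=> 0) t _ mB1.
rewrite (_ : [set w | _] = Y t @^-1` B); last first.
  by apply/seteqP; split => w /=; rewrite /thead tnth_mktuple add0r.
rewrite (_ : [set w | _] = Y 0 @^-1` B); last first.
  by apply/seteqP; split => w /=; rewrite /thead tnth_mktuple.
exact.
Qed.

(** By Tonelli and homogeneity the expectation of the integral over A is lambda(A) E[f(Y(0))], which
    is finite; hence the integral is finite almost surely. *)
Lemma homogeneous_path_lty d (W : measurableType d) (P : probability W R)
    (Y : T -> W -> R) (f : R -> \bar R) (A : set T) :
  random_field Y -> homogeneous P Y ->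
  measurable_fun setT f -> (forall x, 0 <= f x)%E ->
  (\int[P]_w f (Y 0%R w) < +oo)%E ->
  measurable A -> (lambda A < +oo)%E ->
  {ae P, forall w, (\int[lambda]_(t in A) f (Y t w) < +oo)%E}.
Proof.
move=> fY hY mf f0 Yoo mA Aoo.
have mfY : measurable_fun setT (fun p : T * W => f (Y p.1 p.2)).
  exact: (measurableT_comp mf (random_field_measurable fY)).
(* Extension by 0 outside A lets Tonelli run over the whole product space. *)
pose h (p : T * W) := ((fun p : T * W => f (Y p.1 p.2)) \_ (A `*` setT)) p.
have mh : measurable_fun setT h.
  apply/(measurable_restrictT _ _).1; first exact: measurableX.
  exact: measurable_funTS.
have h0 p : (0 <= h p)%E by exact: erestrict_ge0.
have hE w : (\int[lambda]_(t in A) f (Y t w) = \int[lambda]_t h (t, w))%E.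
  rewrite integral_mkcond; apply: eq_integral => t _.
  by rewrite /h !patchE in_setX in_setT andbT.
have mG := measurable_fun_fubini_tonelli_G (m1 := lambda) h mh h0.
rewrite /fubini_G in mG.
suff : (\int[P]_w \int[lambda]_t h (t, w) < +oo)%E.
  move=> Goo; have /integrable_ae : P.-integrable setT
      (fun w => \int[lambda]_t h (t, w))%E.
    apply/integrableP; split => //.
    by under eq_integral do rewrite gee0_abs ?integral_ge0//.
  move=> /(_ measurableT); apply: filterS => w /(_ Logic.I).
  by rewrite hE ge0_fin_numE ?integral_ge0.
rewrite -(fubini_tonelli h)//.
rewrite (eq_integral (fun t => (\int[P]_w f (Y 0%R w)) * (\1_A t)%:E)%E).
  rewrite ge0_integralZl ?integral_ge0//; last first.
    exact/measurable_EFinP/measurable_indic.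
  rewrite integral_indic// setIT lte_mul_pinfty ?integral_ge0//.
  by rewrite ge0_fin_numE ?integral_ge0.
move=> t _; rewrite indicE; case: (boolP (t \in A)) => tA.
  rewrite mule1 -(homogeneous_integral t fY.1 hY mf f0); apply: eq_integral => w _.
  by rewrite /h patchE in_setX tA in_setT.
rewrite mule0; apply: integral0_eq => w _.
by rewrite /h patchE in_setX (negbTE tA).
Qed.

(** The law of [tau] gives no mass to the complement of A and equals lambda / lambda(A) on A, so the
    claim is a change of variables. *)
Lemma uniform_on_expectation d (W : measurableType d) (P : probability W R)
    (A : set T) (tau : {RV P >-> T}) (h : T -> R) :
  measurable A -> (lambda A < +oo)%E -> uniform_on P A tau ->
  measurable_fun setT h -> (forall t, 0 <= h t) ->
  fine 'E_P[fun z => h (tau z)] = space_mean A h.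
Proof.
move=> mA Aoo tauA mh h0; rewrite unlock /space_mean /Rintegral.
have mEh : measurable_fun setT (EFin \o h) by exact/measurable_EFinP.
rewrite -[X in fine X = _](@ge0_integral_pushforward _ _ _ _ _ tau
  (measurable_funPT tau) P setT (EFin \o h))//; last first.
  by move=> y _; rewrite lee_fin.
have v0 : 0 <= (fine (lambda A))^-1 by rewrite invr_ge0 fine_ge0.
have PE B : measurable B ->
    pushforward P tau B = (fine (lambda (B `&` A)) / fine (lambda A))%:E.
  exact: tauA.
have PC : pushforward P tau (~` A) = 0%E.
  by rewrite PE ?setICl ?measure0 ?mul0r//; exact: measurableC.
rewrite (@ge0_negligible_integral _ _ _ _ setT (~` A))//=; last 2 first.
- exact: measurableC.
- by move=> t _; rewrite lee_fin.
rewrite setTD setCK.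
rewrite (eq_measure_integral (mscale (NngNum v0) lambda)); last first.
  move=> B mB BA; apply: (eq_trans (PE B mB)); rewrite /mscale/= setIidl//.
  rewrite EFinM muleC fineK// ge0_fin_numE//.
  apply: le_lt_trans Aoo.
  exact: (le_measure lambda (mem_set mB) (mem_set mA) BA).
rewrite ge0_integral_mscale//=; last 2 first.
- exact: measurable_funTS.
- by move=> t _; rewrite lee_fin.
have : (0 <= \int[lambda]_(x in A) (h x)%:E)%E.
  by apply: integral_ge0 => t _; rewrite lee_fin.
(* Degenerate cases agree by convention: both sides are 0 if the volume is 0, and also if the
   integral is infinite, since [fine] sends +oo to 0. *)
have [Aoo0|A0] := eqVneq (fine (lambda A))^-1 0; first by rewrite Aoo0 mul0e mul0r.
case: (\int[_]_(x in A) _)%E => [r|_|]//=.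
by rewrite mulr0 gt0_muley// lte_fin lt_neqAle eq_sym A0.
Qed.
End index_space.

(** * Conditional expectation and variance given a sub-sigma-field *)

Section conditional_expectation.
Context d (W : measurableType d) (R : realType) (P : probability W R).
Variable G : set (set W).
Hypotheses (sG : sigma_algebra setT G) (Gm : G `<=` measurable).
(** The space W with G as its sigma-field, so that measurability with respect to G becomes ordinary
    measurability on [H]. *)
Local Notation H := (g_sigma_algebraType G).

Let measurableG : (measurable : set (set H)) = G.
Proof. exact: sigma_algebra_id. Qed.

Lemma is_cond_expectation_measurable (Z g : W -> R) :
  is_cond_expectation P G Z g -> measurable_fun [set: H] g.
Proof. by case=> mg _ _ _ B mB; rewrite setTI measurableG; exact: mg. Qed.

Let measurable_set_ltr (f g : W -> R) : measurable_fun [set: H] f ->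
  measurable_fun [set: H] g -> G [set w | f w < g w].
Proof.
move=> mf mg; rewrite -measurableG -[X in measurable X]setTI.
exact: (measurable_fun_ltr mf mg measurableT (Y := [set true])).
Qed.

Let measurable_set_ler (f g : W -> R) : measurable_fun [set: H] f ->
  measurable_fun [set: H] g -> G [set w | f w <= g w].
Proof.
move=> mf mg; rewrite -measurableG -[X in measurable X]setTI.
exact: (measurable_fun_ler mf mg measurableT (Y := [set true])).
Qed.

Lemma is_cond_expectation_Rintegral (Z g : W -> R) (A : set W) :
  is_cond_expectation P G Z g -> G A ->
  \int[P]_(w in A) g w = \int[P]_(w in A) Z w.
Proof. by case=> _ _ gE GA; congr fine; exact: gE. Qed.

(* No integrability is needed: without a version, [cond_expectation] is the junk
   value 0, which is not positive. *)
Lemma cond_expectationP_ae_gt0 (Z : W -> R) :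
  {ae P, forall w, 0 < cond_expectation P G Z w} ->
  is_cond_expectation P G Z (cond_expectation P G Z).
Proof.
move=> ce0; rewrite /cond_expectation.
have [[g gP]|nog] := pselect (exists g, is_cond_expectation P G Z g).
  exact: (xgetPex (cst 0) (ex_intro _ g gP)).
exfalso; move: ce0; rewrite /cond_expectation xgetPN; last first.
  by move=> g gP; apply: nog; exists g.
rewrite /prop_near1/nbhs/= => -[A [mA PA0]].
rewrite (_ : ~` _ = setT); last first.
  by apply/seteqP; split => // w _ /=; rewrite ltxx.
rewrite subTset => AT; move: PA0.
by rewrite AT probability_setT => /eqP; rewrite onee_eq0.
Qed.

(* On the event C where [E[Z^2 | G] <= g^2], [cv >= 5 delta^2] and
   [|g - q| < delta], with g = E[Z | G] and cv the conditional variance, replacing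
   g by the constant q gives 5 delta^2 P(C) <= int_C (Z - g)^2 <=
   2 int_C (Z - q)^2 + 2 delta^2 P(C) <= 4 delta^2 P(C). Countably many such null
   events cover [E[Z^2 | G] <= g^2]; integrability of [g * Z] is never used. *)
Lemma cond_variance_gt0 (Z : W -> R) :
  P.-integrable setT (EFin \o Z) ->
  P.-integrable setT (EFin \o (fun w => Z w ^+ 2)) ->
  {ae P, forall w, 0 < cond_variance P G Z w} ->
  {ae P, forall w, cond_expectation P G Z w ^+ 2 <
                   cond_expectation P G (fun w => Z w ^+ 2) w}.
Proof.
move=> iZ iZ2 cv0.
have cvP := cond_expectationP_ae_gt0 cv0.
have gP := cond_expectationP sG Gm iZ.
have hP := cond_expectationP sG Gm iZ2.
rewrite -/(cond_variance P G Z) in cvP.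
set cv := cond_variance P G Z in cv0 cvP *.
set g := cond_expectation P G Z in gP cvP *.
set h := cond_expectation P G _ in hP *.
pose delta n : R := n.+1%:R^-1.
have delta0 n : 0 < delta n by rewrite invr_gt0.
pose C n q := [set w | h w - g w ^+ 2 <= 0] `&` [set w | 5 * delta n ^+ 2 <= cv w]
  `&` [set w | `|g w - ratr q| < delta n].
have mg := is_cond_expectation_measurable gP.
have mh := is_cond_expectation_measurable hP.
have mcv := is_cond_expectation_measurable cvP.
have GC n q : G (C n q).
  rewrite -measurableG; apply: measurableI; first apply: measurableI.
  - rewrite measurableG; apply: measurable_set_ler => //.
    by apply: measurable_funB => //; exact: measurable_funX.
  - by rewrite measurableG; exact: measurable_set_ler.
  - rewrite measurableG; apply: measurable_set_ltr => //.
    by apply: measurableT_comp => //; exact: measurable_funB.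
have PC n q : P (C n q) = 0%E.
  set A := C n q; have GA : G A := GC n q; have mA : measurable A := Gm GA.
  have iA f : P.-integrable setT (EFin \o f) -> P.-integrable A (EFin \o f).
    exact: integrableS.
  have icst r : P.-integrable A (EFin \o cst r).
    exact: finite_measure_integrable_cst.
  pose s : R := ratr q; pose e := delta n.
  have iM r f : P.-integrable setT (EFin \o f) ->
      P.-integrable A (EFin \o (fun w => r * f w)).
    by move=> /iA/(integrableZl mA r).
  (* The form f2 - 2 s f1 + s^2 is used for the pairs (Z^2, Z) and (h, g). For the first it is (Z -
     s)^2; both have the same integral over A because A belongs to G. *)
  have iq (f2 f1 : W -> R) : P.-integrable setT (EFin \o f2) ->
      P.-integrable setT (EFin \o f1) ->
      P.-integrable A (EFin \o (fun w => f2 w - 2 * s * f1 w)).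
    by move=> /iA i2 /(iM (2 * s)) i1; exact: (integrableB mA i2 i1).
  have iq' (f2 f1 : W -> R) : P.-integrable setT (EFin \o f2) ->
      P.-integrable setT (EFin \o f1) ->
      P.-integrable A (EFin \o (fun w => f2 w - 2 * s * f1 w + s ^+ 2)).
    by move=> i2 i1; exact: (integrableD mA (iq _ _ i2 i1) (icst (s ^+ 2))).
  have iM2 (f2 f1 : W -> R) : P.-integrable setT (EFin \o f2) ->
      P.-integrable setT (EFin \o f1) ->
      P.-integrable A (EFin \o (fun w => 2 * (f2 w - 2 * s * f1 w + s ^+ 2))).
    by move=> i2 i1; exact: (integrableZl mA 2 (iq' _ _ i2 i1)).
  have Eq (f2 f1 : W -> R) : P.-integrable setT (EFin \o f2) ->
      P.-integrable setT (EFin \o f1) ->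
      \int[P]_(w in A) (f2 w - 2 * s * f1 w + s ^+ 2) =
      \int[P]_(w in A) f2 w - 2 * s * \int[P]_(w in A) f1 w + s ^+ 2 * fine (P A).
    move=> i2 i1; rewrite RintegralD//; [|exact: iq|exact: icst].
    rewrite RintegralB//; [|exact: iA|exact: iM].
    by rewrite RintegralZl ?Rintegral_cst//; exact: iA.
  have ig : P.-integrable setT (EFin \o g) by case: gP.
  have ih : P.-integrable setT (EFin \o h) by case: hP.
  have icv : P.-integrable setT (EFin \o cv) by case: cvP.
  have iB (f2 f1 : W -> R) : P.-integrable setT (EFin \o f2) ->
      P.-integrable setT (EFin \o f1) -> P.-integrable A
        (EFin \o (fun w => 2 * (f2 w - 2 * s * f1 w + s ^+ 2) + 2 * e ^+ 2)).
    by move=> i2 i1; exact: (integrableD mA (iM2 _ _ i2 i1) (icst (2 * e ^+ 2))).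
  have EB (f2 f1 : W -> R) : P.-integrable setT (EFin \o f2) ->
      P.-integrable setT (EFin \o f1) ->
      \int[P]_(w in A) (2 * (f2 w - 2 * s * f1 w + s ^+ 2) + 2 * e ^+ 2) =
      2 * (\int[P]_(w in A) f2 w - 2 * s * \int[P]_(w in A) f1 w
           + s ^+ 2 * fine (P A)) + 2 * e ^+ 2 * fine (P A).
    move=> i2 i1; rewrite RintegralD//; [|exact: iM2|exact: icst].
    by rewrite RintegralZl ?Eq ?Rintegral_cst//; exact: iq'.
  have sqr_norm_le (a : R) : `|a| < e -> a ^+ 2 <= e ^+ 2.
    by move=> /ltW; rewrite ler_norml => /andP[]; nra.
  have bound w : A w -> (Z w - g w) ^+ 2 <=
      2 * (Z w ^+ 2 - 2 * s * Z w + s ^+ 2) + 2 * e ^+ 2.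
    move=> [_ /=]; rewrite -/s -/e => gs.
    have := sqr_norm_le _ gs.
    (* Parallelogram law: 2 (Z - s)^2 + 2 (g - s)^2 = (Z - g)^2 + (Z + g - 2 s)^2. *)
    have := sqr_ge0 (Z w + g w - 2 * s); nra.
  have iZg : P.-integrable A (EFin \o (fun w => (Z w - g w) ^+ 2)).
    apply: le_integrable (iB _ _ iZ2 iZ) => //.
      apply/measurable_EFinP/measurable_funX/measurable_funB.
        by apply/measurable_EFinP; apply: measurable_int (iA _ iZ).
      by apply/measurable_EFinP; apply: measurable_int (iA _ ig).
    move=> w Aw /=; rewrite lee_fin ger0_norm ?sqr_ge0//.
    exact: le_trans (bound w Aw) (ler_norm _).
  have key : 5 * e ^+ 2 * fine (P A) <= 4 * e ^+ 2 * fine (P A).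
    rewrite -!Rintegral_cst//.
    apply: (@le_trans _ _ (\int[P]_(w in A) cv w)).
      by apply: le_Rintegral => //; [exact: icst|exact: iA|move=> w [[]]].
    rewrite (is_cond_expectation_Rintegral cvP GA).
    apply: (@le_trans _ _ (\int[P]_(w in A)
        (2 * (Z w ^+ 2 - 2 * s * Z w + s ^+ 2) + 2 * e ^+ 2))).
      by apply: le_Rintegral => //; exact: iB.
    rewrite EB// -(is_cond_expectation_Rintegral gP GA).
    rewrite -(is_cond_expectation_Rintegral hP GA) -EB//.
    (* On A, h <= g^2 gives h - 2 s g + s^2 <= (g - s)^2 <= e^2, so the integrand is at most 4
       e^2. *)
    apply: le_Rintegral => //; [exact: iB|exact: icst|].
    move=> w [[/= hg _] gs]; rewrite -/s -/e in gs.
    have := sqr_norm_le _ gs.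
    move: hg; nra.
  have e2 : 0 < e ^+ 2 := exprn_gt0 2 (delta0 n).
  have PA0 : fine (P A) = 0.
    have : 0 <= fine (P A) by exact: fine_ge0.
    nra.
  by rewrite -[P A]fineK ?PA0// fin_num_measure.
(* The rationals q are enumerated by their codes p; a code of no rational stands for the empty
   event. *)
have : {ae P, forall w, forall n p,
    ~ (if unpickle p is Some q then C n q w else False)}.
  apply: ae_foralln => n; apply: ae_foralln => p.
  case: (unpickle p) => [q|]; last by apply: aeW => w [].
  exists (C n q); split; [exact/Gm/GC|exact: PC|].
  by move=> w /= /contrapT.
move: cv0; apply: filterS2 => w cvw nC.
rewrite ltNge; apply/negP => hg.
have [n nP] : exists n, delta n < cv w / 5.
  have [n] := @ltr_add_invr R 0 (cv w / 5) ltac:(by rewrite divr_gt0).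
  by rewrite add0r; exists n.
have [q] := @rat_in_itvoo R (g w - delta n) (g w + delta n) ltac:(have := delta0 n; lra).
rewrite in_itv/= => /andP[q1 q2].
apply: (nC n (pickle q)); rewrite pickleK; split; first split => /=.
- by rewrite subr_le0.
(* As delta <= 1, 5 delta^2 <= 5 delta < cv. *)
- have : delta n <= 1 by rewrite invf_le1// ler1n.
  have := delta0 n; nra.
- by rewrite /= ltr_norml; apply/andP; split; lra.
Qed.


(** Let D be the event in G where E[Z_K | G] >= 1/(j+1) for all K >= K0. Then P(D)/(j+1) <= int_D
    Z_K <= E[Z_K] for every such K, and the right side tends to 0, so D is null. The bound K0 leaves
    K free to be taken large later. *)
Lemma cond_expectation_small (Z : nat -> W -> R) :
  (forall K, P.-integrable setT (EFin \o Z K)) ->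
  (forall K w, 0 <= Z K w) ->
  \int[P]_w Z K w @[K --> \oo] --> 0 ->
  {ae P, forall w, forall e K0, 0 < e ->
    exists2 K, (K0 <= K)%N & cond_expectation P G (Z K) w < e}.
Proof.
move=> iZ Z0 Zcvg.
have ceP K := cond_expectationP sG Gm (iZ K).
pose D j K0 := \bigcap_K [set w | j.+1%:R^-1 <= cond_expectation P G (Z (K0 + K)%N) w].
have GD j K0 : G (D j K0).
  rewrite -measurableG; apply: bigcapT_measurable => K.
  rewrite measurableG; apply: measurable_set_ler => //.
  exact: is_cond_expectation_measurable (ceP _).
have PD j K0 : P (D j K0) = 0%E.
  have mD := Gm (GD j K0).
  suff PD0 : fine (P (D j K0)) = 0.
    by rewrite -[P _]fineK ?PD0 ?fin_num_measure.
  apply/eqP; rewrite eq_le fine_ge0// andbT leNgt; apply/negP => PDgt0.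
  have e0 : 0 < j.+1%:R^-1 * fine (P (D j K0)) by rewrite mulr_gt0 ?invr_gt0.
  have /cvgrPdist_lt/(_ _ e0)[N _ /(_ (K0 + N)%N (leq_addl _ _))] := Zcvg.
  rewrite /= sub0r normrN; apply/negP; rewrite -leNgt.
  apply: le_trans (ler_norm _).
  rewrite -Rintegral_cst//.
  apply: (@le_trans _ _ (\int[P]_(w in D j K0) cond_expectation P G (Z (K0 + N)%N) w)).
    apply: le_Rintegral => //; first exact: finite_measure_integrable_cst.
      by have [_ i _] := ceP (K0 + N)%N; exact: integrableS i.
    by move=> w /(_ N Logic.I).
  rewrite (is_cond_expectation_Rintegral (ceP _) (GD _ _)).
  rewrite /Rintegral fine_le//.
  - by apply: integrable_fin_num => //; exact: integrableS (iZ _).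
  - exact: (integrable_fin_num measurableT (iZ _)).
  - apply: ge0_subset_integral => //; first exact: measurable_int (iZ _).
    by move=> w _; rewrite lee_fin.
have : {ae P, forall w, forall j K0, ~ D j K0 w}.
  apply: ae_foralln => j; apply: ae_foralln => K0.
  exists (D j K0); split; [exact/Gm/GD|exact: PD|].
  by move=> w /= /contrapT.
apply: filterS => w nD e K0 e0.
have [j] := @ltr_add_invr R 0 e e0; rewrite add0r => je.
have /existsNP[K] := fun h => nD j K0 h.
move=> /not_implyP[_ /negP]; rewrite -ltNge => Kj.
by exists (K0 + K)%N; [exact: leq_addr|exact: lt_trans je].
Qed.
End conditional_expectation.

(** * Truncations and sample moments along one realization *)

Lemma measurable_indic_gt_norm d (S : measurableType d) (R : realType)
    (f : S -> R) (b : R) : measurable_fun setT f ->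
  measurable_fun setT (\1_[set s | b < `|f s|] : S -> R).
Proof.
move=> mf; apply: measurable_indic; rewrite -[X in measurable X]setTI.
apply: (@measurable_fun_ltr _ S R setT (cst b) (fun s => `|f s|) _ _ _ [set true]) => //.
exact: measurableT_comp.
Qed.

Lemma measurable_sqr_tail (R : realType) (K : R) :
  measurable_fun setT (fun y : R => y ^+ 2 * \1_[set y | K < `|y|] y).
Proof.
apply: measurable_funM; first exact: measurable_funX.
exact: measurable_indic_gt_norm.
Qed.

Section sample_moments.
Context (R : realType) (m : nat) (c : index_kind).
Local Notation T := (index_space R m c).
Local Notation lambda := (reference_measure R m c).
Variable A : set T.
Hypotheses (mA : measurable A) (A_gt0 : (0 < lambda A)%E)
  (A_lty : (lambda A < +oo)%E).
Variable x : T -> R.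
Hypotheses (mx : measurable_fun setT x)
  (x2_lty : (\int[lambda]_(t in A) (x t ^+ 2)%:E < +oo)%E).

Let vol_gt0 : 0 < fine (lambda A).
Proof. by rewrite fine_gt0// A_gt0. Qed.

Let integrable_cst (r : R) : lambda.-integrable A (EFin \o cst r).
Proof.
apply: measurable_bounded_integrable => //.
by exists `|r|; split => [|y /ltW ry t _]; first exact: num_real.
Qed.

Let integrable_x2 : lambda.-integrable A (EFin \o (fun t => x t ^+ 2)).
Proof.
apply/integrableP; split.
  by apply/measurable_EFinP; apply: measurable_funTS; exact: measurable_funX.
under eq_integral do rewrite /= ger0_norm ?sqr_ge0//.
exact: x2_lty.
Qed.

Let integrable_x : lambda.-integrable A (EFin \o x).
Proof.
(* On a set of finite volume, |x| is dominated by the integrable x^2 + 1. *)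
have i1 : lambda.-integrable A (EFin \o (fun t => x t ^+ 2 + 1)).
  exact: (integrableD mA integrable_x2 (integrable_cst 1)).
apply: le_integrable i1 => //.
  by apply/measurable_EFinP; exact: measurable_funTS.
move=> t At /=; rewrite lee_fin; apply: le_trans (ler_norm _).
rewrite ler_norml; apply/andP; split; nra.
Qed.

(** Expanding the square reduces the convergence of V_n to that of the averages of x and x^2. *)
Lemma sample_varianceE :
  sample_variance A x = space_mean A (fun t => x t ^+ 2) - space_mean A x ^+ 2.
Proof.
rewrite /sample_variance; set M := space_mean A x.
have iM : lambda.-integrable A (EFin \o (fun t => 2 * M * x t)).
  exact: (integrableZl mA (2 * M) integrable_x).
rewrite /space_mean.
under eq_Rintegral => t _.
  rewrite (_ : (x t - M) ^+ 2 = x t ^+ 2 - 2 * M * x t + M ^+ 2); last by ring.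
  over.
rewrite RintegralD//; [|exact: (integrableB mA integrable_x2 iM)|exact: integrable_cst].
rewrite RintegralB// RintegralZl// Rintegral_cst//.
have -> : \int[lambda]_(t in A) x t = fine (lambda A) * M.
  by rewrite /M /space_mean mulrA divff ?mul1r// gt_eqF.
by field; rewrite gt_eqF.
Qed.

(** Where |x - M| > b >= 2K, the triangle inequality gives |x| > K >= |M|, hence (x - M)^2 <=
    (2|x|)^2 = 4 x^2. *)
Lemma space_mean_deviation_tail (M b K : R) : `|M| <= K -> 2 * K <= b ->
  space_mean A (fun t => (x t - M) ^+ 2 * \1_[set t | b < `|x t - M|] t) <=
  4 * space_mean A (fun t => x t ^+ 2 * \1_[set y | K < `|y|] (x t)).
Proof.
move=> MK Kb; rewrite /space_mean mulrCA ler_wpM2l ?invr_ge0 ?fine_ge0//.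
have mtail : measurable_fun setT
    (fun t => x t ^+ 2 * \1_[set y : R | K < `|y|] (x t)).
  exact: (measurableT_comp (measurable_sqr_tail K) mx).
have mdev : measurable_fun setT
    (fun t => (x t - M) ^+ 2 * \1_[set t | b < `|x t - M|] t).
  have mxM : measurable_fun setT (fun t => x t - M) by exact: measurable_funB.
  apply: measurable_funM; first exact: measurable_funX.
  exact: measurable_indic_gt_norm.
have itail : lambda.-integrable A
    (EFin \o (fun t => x t ^+ 2 * \1_[set y : R | K < `|y|] (x t))).
  apply: le_integrable integrable_x2 => //.
    by apply/measurable_EFinP; exact: measurable_funTS.
  move=> t At /=; rewrite lee_fin normrM ler_piMr//.
  by rewrite indicE; case: (_ \in _); rewrite ?normr1 ?normr0.
have bound t : (x t - M) ^+ 2 * \1_[set t | b < `|x t - M|] t <=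
    4 * (x t ^+ 2 * \1_[set y : R | K < `|y|] (x t)).
  rewrite !indicE; have [|_] := boolP (t \in _); last first.
    by rewrite mulr0; do 2![apply: mulr_ge0 => //]; exact: sqr_ge0.
  rewrite in_setE/= => bx.
  have xK : K < `|x t| by have := ler_normB (x t) M; lra.
  rewrite mem_set// !mulr1.
  move: MK xK; rewrite ler_norml => /andP[].
  by case: (ler0P (x t)) => *; nra.
have i4 := integrableZl mA 4 itail.
rewrite -RintegralZl//; apply: le_Rintegral => //.
apply: le_integrable i4 => //.
  by apply/measurable_EFinP; exact: measurable_funTS.
move=> t At /=; rewrite lee_fin ger0_norm; last first.
  by apply: mulr_ge0 => //; exact: sqr_ge0.
exact: le_trans (bound t) (ler_norm _).
Qed.

(** Since every point is uniform on A, the k summands are one and the same space average, and the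
    factor k > 0 cancels. *)
Lemma lindeberg_ratioE d (W : measurableType d) (P : probability W R) k
    (tau : 'I_k -> {RV P >-> T}) (eps : R) :
  (0 < k)%N -> (forall i, uniform_on P A (tau i)) ->
  let M := space_mean A x in let V := sample_variance A x in
  lindeberg_ratio P A (fun i => tau i : _ -> _) x eps =
  space_mean A (fun t => (x t - M) ^+ 2 *
    \1_[set t | eps * Num.sqrt k%:R * Num.sqrt V < `|x t - M|] t) / V.
Proof.
move=> k0 utau M V; rewrite /lindeberg_ratio -/M -/V.
set b := eps * _ * _.
pose h t := (x t - M) ^+ 2 * \1_[set t | b < `|x t - M|] t.
have mh : measurable_fun setT h.
  have mxM : measurable_fun setT (fun t => x t - M) by exact: measurable_funB.
  apply: measurable_funM; first exact: measurable_funX.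
  exact: measurable_indic_gt_norm.
have h0 t : 0 <= h t by apply: mulr_ge0 => //; exact: sqr_ge0.
rewrite (eq_bigr (fun=> space_mean A h)); last first.
  move=> i _; rewrite -(uniform_on_expectation mA A_lty (utau i) mh h0).
  by [].
have k_neq0 : k%:R != 0 :> R by rewrite pnatr_eq0 -lt0n.
have cancelk (a v : R) : k%:R * a / (k%:R * v) = a / v.
  by rewrite invfM mulrACA divff// mul1r.
by rewrite sumr_const card_ord -(mulr_natl (space_mean A h)) cancelk.
Qed.
End sample_moments.

(** * Deterministic Lindeberg convergence for a fixed realization *)

Section lindeberg.
Context (R : realType) (m : nat) (c : index_kind).
Local Notation T := (index_space R m c).
Local Notation lambda := (reference_measure R m c).

Lemma space_mean_ge0 (A : set T) (f : T -> R) :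
  (forall t, 0 <= f t) -> 0 <= space_mean A f.
Proof.
move=> f0; apply: mulr_ge0; first by rewrite invr_ge0 fine_ge0.
exact: Rintegral_ge0.
Qed.

(** Here x is one realization; g, h and [a K] stand for the values there of the conditional
    expectations of X(0), X(0)^2 and X(0)^2 1{|X(0)| > K}. *)
Lemma lindeberg_ratio_cvg0 (S : nat -> set T) (x : T -> R) (k : nat -> nat)
    d (W : measurableType d) (P : probability W R)
    (tau : forall n, 'I_(k n) -> {RV P >-> T}) (g h : R) (a : nat -> R) (eps : R) :
  (forall n, [/\ measurable (S n), 0 < lambda (S n) & lambda (S n) < +oo]%E) ->
  measurable_fun setT x ->
  (forall n, \int[lambda]_(t in S n) (x t ^+ 2)%:E < +oo)%E ->
  space_mean (S n) x @[n --> \oo] --> g ->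
  space_mean (S n) (fun t => x t ^+ 2) @[n --> \oo] --> h ->
  g ^+ 2 < h ->
  (forall K, space_mean (S n)
      (fun t => x t ^+ 2 * \1_[set y : R | K%:R < `|y|] (x t))
    @[n --> \oo] --> a K) ->
  (forall e K0, 0 < e -> exists2 K, (K0 <= K)%N & a K < e) ->
  k n @[n --> \oo] --> \oo ->
  (forall n i, uniform_on P (S n) (tau n i)) ->
  0 < eps ->
  lindeberg_ratio P (S n) (fun i => tau n i : _ -> _) x eps @[n --> \oo] --> 0.
Proof.
move=> HS mx x2 cM cx2 gh ca a_small ck utau eps0.
pose v := h - g ^+ 2; have v0 : 0 < v by rewrite subr_gt0.
have cV : sample_variance (S n) x @[n --> \oo] --> v.
  rewrite (_ : (fun n => _) = (fun n =>
      space_mean (S n) (fun t => x t ^+ 2) - space_mean (S n) x ^+ 2)).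
    exact: (cvgB cx2 (cvgM cM cM)).
  by apply/funext => n; have [mS S0 Soo] := HS n; rewrite sample_varianceE.
apply/cvgrPdist_lt => e e0.
(* A tail average below e v / 8, times the factor 4, is below e v / 2, hence below e V once V > v /
   2. *)
have eV0 : 0 < e * v / 8 by rewrite divr_gt0 ?mulr_gt0.
(* The lower bound imposed on K makes K > |g|, so that |M_n| <= K eventually. *)
have [K gK aK] := a_small _ (Num.bound (`|g| + 1)) eV0.
have {}gK : `|g| < K%:R.
  apply: (@lt_le_trans _ _ (Num.bound (`|g| + 1))%:R); last by rewrite ler_nat.
  by apply: lt_trans (archi_boundP _); rewrite ?ltrDl// addr_ge0.
(* For k_n > N and V > v / 2, k_n V >= (2K / eps)^2, so the truncation threshold is at least 2K. *)
pose N := Num.bound ((2 * K%:R / eps) ^+ 2 / (v / 2)).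
have NP : (2 * K%:R / eps) ^+ 2 <= N%:R * (v / 2).
  rewrite -ler_pdivrMr ?divr_gt0//; apply/ltW/archi_boundP.
  by rewrite divr_ge0 ?sqr_ge0 ?divr_ge0// ltW.
near=> n.
have [mS S0 Soo] := HS n.
have kN : (N < k n)%N.
  by near: n; move/cvgnyPgt : ck; exact.
have k0 : (0 < k n)%N by exact: leq_ltn_trans kN.
have Vv : v / 2 < sample_variance (S n) x.
  by near: n; apply: cvgr_gt cV _ _; lra.
have MK : `|space_mean (S n) x| <= K%:R.
  by near: n; exact: cvgr_norm_le cM _ gK.
have tail : space_mean (S n)
    (fun t => x t ^+ 2 * \1_[set y : R | K%:R < `|y|] (x t)) < e * v / 8.
  by near: n; exact: cvgr_lt (ca K) _ aK.
rewrite sub0r normrN (lindeberg_ratioE mS Soo mx)//.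
set M := space_mean (S n) x in MK *; set V := sample_variance (S n) x in Vv *.
have V0 : 0 < V by apply: lt_trans Vv; rewrite divr_gt0.
set b := eps * _ * _.
have Kb : 2 * K%:R <= b.
  rewrite /b -mulrA -sqrtrM// [leRHS]mulrC -ler_pdivrMr//.
  have q0 : 0 <= 2 * K%:R / eps by rewrite divr_ge0// ltW.
  rewrite -(ger0_norm q0) -sqrtr_sqr ler_sqrt; last by rewrite mulr_ge0// ltW.
  apply: (le_trans NP); apply: ler_pM => //; last exact: ltW.
    by rewrite divr_ge0// ltW.
  by rewrite ler_nat ltnW.
rewrite ger0_norm; last first.
  rewrite divr_ge0 ?(ltW V0)//; apply: space_mean_ge0 => t.
  by apply: mulr_ge0 => //; exact: sqr_ge0.
rewrite ltr_pdivrMr//.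
have tail2 := space_mean_deviation_tail mS mx (x2 n) MK Kb.
have eV : e * (v / 2) < e * V by rewrite ltr_pM2l.
lra.
Unshelve. all: by end_near. Qed.
End lindeberg.

(** * Vanishing truncated moments and the almost sure statement *)

(** Dominated convergence with dominating function Z^2: at each w the integrand is 0 for all large
    K. *)
Lemma sqr_tail_cvg0 d (W : measurableType d) (R : realType) (P : probability W R)
    (Z : W -> R) :
  P.-integrable setT (EFin \o (fun w => Z w ^+ 2)) -> measurable_fun setT Z ->
  \int[P]_w (Z w ^+ 2 * \1_[set y : R | K%:R < `|y|] (Z w)) @[K --> \oo] --> 0.
Proof.
move=> iZ2 mZ.
pose F K w := (Z w ^+ 2 * \1_[set y : R | K%:R < `|y|] (Z w))%:E.
have mF K : measurable_fun setT (F K).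
  apply/measurable_EFinP; exact: (measurableT_comp (measurable_sqr_tail _) mZ).
have F0 : {ae P, forall w, [set: W] w -> F ^~ w @ \oo --> (cst 0 w : \bar R)}.
  apply: aeW => w _; apply: cvg_near_cst.
  exists (Num.bound `|Z w|) => // K /= ZK.
  rewrite /F indicE memNset ?mulr0//= => /lt_trans.
  move=> /(_ _ (archi_boundP (normr_ge0 _))).
  by rewrite ltr_nat ltnNge ZK.
have Fb : {ae P, forall w K, [set: W] w -> (`|F K w| <= (Z w ^+ 2)%:E)%E}.
  apply: aeW => w K _; rewrite /F lee_fin normrM ger0_norm ?sqr_ge0// ler_piMr ?sqr_ge0//.
  by rewrite indicE; case: (_ \in _); rewrite ?normr1 ?normr0.
have [_ _ +] := dominated_convergence measurableT mF (measurable_cst _) F0 iZ2 Fb.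
by rewrite integral0 => /fine_cvg.
Qed.

Theorem proposition1 (R : realType) (m : nat) (c : index_kind) (m_gt0 : (0 < m)%N)
    (dX : measure_display) (OmegaX : measurableType dX)
    (PX : probability OmegaX R)
    (X : index_space R m c -> OmegaX -> R)
    (X_field : random_field X)
    (X_homogeneous : homogeneous PX X)
    (X_square_integrable : ('E_PX[fun w => (X 0 w ^+ 2)%R] < +oo)%E)
    (X_variance_gt0 :
      {ae PX, forall w, 0 < cond_variance PX (invariant_events PX X) (X 0) w})
    (T_ : nat -> set (index_space R m c))
    (T_averaging : pointwise_averaging T_)
    (k : nat -> nat)
    (k_nondecreasing : {homo k : a b / (a <= b)%N})
    (k_unbounded : k n @[n --> \oo] --> \oo)
    (dtau : measure_display) (Omegatau : measurableType dtau)
    (Ptau : probability Omegatau R)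
    (tau : forall n, 'I_(k n) -> {RV Ptau >-> index_space R m c})
    (tau_independent :
      forall n, mutually_independent Ptau (fun i => tau n i : _ -> _))
    (tau_uniform : forall n i, uniform_on Ptau (T_ n) (tau n i)) :
  {ae PX, forall w, forall eps : R, 0 < eps ->
    lindeberg_ratio Ptau (T_ n) (fun i => tau n i : _ -> _) (X ^~ w) eps
      @[n --> \oo] --> 0}.
Proof.
have [mX _] := X_field.
have [HT _ Tavg] := T_averaging.
have HS n : [/\ measurable (T_ n), 0 < reference_measure R m c (T_ n)
    & reference_measure R m c (T_ n) < +oo]%E.
  by have [mT bT T0] := HT n; split => //; exact: bounded_index_lty.
have iX2 : PX.-integrable setT (EFin \o (fun w => X 0 w ^+ 2)).
  apply/integrableP; split.
    by apply/measurable_EFinP; exact: measurable_funX.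
  move: X_square_integrable; rewrite unlock; apply: le_lt_trans.
  by under eq_integral do rewrite /= ger0_norm ?sqr_ge0//.
have iX : PX.-integrable setT (EFin \o X 0).
  have i1 : PX.-integrable setT (EFin \o (fun w => X 0 w ^+ 2 + 1)).
    exact: (integrableD measurableT iX2 (finite_measure_integrable_cst PX 1 measurableT)).
  apply: le_integrable i1 => //; first exact/measurable_EFinP.
  move=> w _ /=; rewrite lee_fin; apply: le_trans (ler_norm _).
  rewrite ler_norml; apply/andP; split; nra.
have iXK K : PX.-integrable setT
    (EFin \o (fun w => X 0 w ^+ 2 * \1_[set y : R | K%:R < `|y|] (X 0 w))).
  apply: le_integrable iX2 => //.
    apply/measurable_EFinP.
    exact: (measurableT_comp (measurable_sqr_tail K%:R) (mX 0)).
  move=> w _ /=; rewrite lee_fin normrM ler_piMr//.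
  by rewrite indicE; case: (_ \in _); rewrite ?normr1 ?normr0.
(* Averaging is applied below to the identity, the square and each truncated square. *)
have avg (f : R -> R) : measurable_fun setT f ->
    PX.-integrable setT (EFin \o (fun w => f (X 0 w))) ->
    {ae PX, forall w, space_mean (T_ n) (fun t => f (X t w)) @[n --> \oo] -->
      cond_expectation PX (invariant_events PX X) (fun w => f (X 0 w)) w}.
  move=> mf /integrableP[_ ioo]; apply: Tavg => //.
  by rewrite unlock.
have sI := sigma_algebra_invariant_events PX mX.
have Im := invariant_events_measurable (P := PX) mX.
have ae_gh := cond_variance_gt0 sI Im iX iX2 X_variance_gt0.
have tail_ge0 K w : 0 <= X 0 w ^+ 2 * \1_[set y : R | K%:R < `|y|] (X 0 w) :> R.
  by apply: mulr_ge0 => //; exact: sqr_ge0.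
have ae_small := cond_expectation_small sI Im iXK tail_ge0 (sqr_tail_cvg0 iX2 (mX 0)).
have ae_M := avg id (@measurable_id _ _ _) iX.
have ae_X2 := avg (fun y => y ^+ 2) (measurable_funX 2 (@measurable_id _ _ _)) iX2.
have ae_XK : {ae PX, forall w, forall K, _} :=
  ae_foralln (fun K => avg _ (measurable_sqr_tail K%:R) (iXK K)).
(* Finite second moments along the realization ensure that [Rintegral] returns true integrals, not
   its default 0, when the square in V_n is expanded. *)
have ae_lty : {ae PX, forall w, forall n,
    (\int[reference_measure R m c]_(t in T_ n) (X t w ^+ 2)%:E < +oo)%E}.
  apply: ae_foralln => n; have [mT _ Too] := HS n.
  apply: (homogeneous_path_lty (f := fun y => (y ^+ 2)%:E) X_field X_homogeneous) => //.
  - by apply/measurable_EFinP; exact: measurable_funX.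
  - by move=> y; rewrite lee_fin sqr_ge0.
  - by move: X_square_integrable; rewrite unlock.
(* None of the almost sure facts mentions [eps], so one null set serves all [eps]. *)
near=> w; move=> eps eps0.
apply: (lindeberg_ratio_cvg0 HS (random_field_path w X_field)
  (near ae_lty w _) (near ae_M w _) (near ae_X2 w _) (near ae_gh w _)
  (near ae_XK w _) (near ae_small w _) k_unbounded tau_uniform eps0) => //.
Unshelve. all: by end_near. Qed.
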